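(* Let $H$ be a graph with vertices $w_1,\dots,w_k$, $k\ge 2$, let $n$ be a positive integer and $0<\rho\le 1$. If $G$ is a subgraph of $H[n]$ containing at least $\rho n^k$ canonical copies of $H$, then $G$ contains a canonical copy of $H[t,\dots,t,n^{1-\rho^{k-1}}]$, where $t=\lfloor \rho^k 4^{-k^2+k}\log n\rfloor$; that is, there are sets $S_i\subseteq U_i$ with $|S_i|=t$ for $i<k$ and $|S_k|\ge n^{1-\rho^{k-1}}$ such that for every edge $w_iw_j$ of $H$ all edges between $S_i$ and $S_j$ belong to $G$.
   Context: $\log$ denotes the natural logarithm. $H[n]$ is the $n$-blowup of $H$: each vertex $w_i$ is replaced by an independent set $U_i$ of $n$ vertices, and for each edge $w_iw_j$ of $H$ a complete bipartite graph is placed between $U_i$ and $U_j$. A canonical copy of $H$ in a subgraph $G\subseteq H[n]$ is a choice of one vertex $u_i\in U_i$ for each $i$ such that $u_iu_j\in E(G)$ for every edge $w_iw_j$ of $H$. More generally, a canonical copy of $H[t_1,\dots,t_k]$ in $G$ is given by sets $S_i\subseteq U_i$, $|S_i|=t_i$, such that all edges between $S_i$ and $S_j$ lie in $G$ whenever $w_iw_j\in E(H)$. *)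

(* Defs.v *)
From HB Require Import structures.
From mathcomp Require Import all_boot all_order all_algebra.
From mathcomp Require Import all_classical all_reals all_analysis.

Set Implicit Arguments.
Unset Strict Implicit.
Unset Printing Implicit Defensive.

Record sgraph (V : finType) := SGraph {
  adj :> rel V;
  adj_sym : symmetric adj;
  adj_irr : irreflexive adj }.

Definition subgraph (V : finType) (G K : sgraph V) : Prop :=
  forall x y, G x y -> K x y.

Section Blowup.
Variables (k n : nat) (H : sgraph 'I_k).

(* The vertex (i, a) is the a-th element of the class U_i. *)
Definition blowup_rel : rel ('I_k * 'I_n) := fun x y => H x.1 y.1.

Lemma blowup_sym : symmetric blowup_rel.
Proof. by move=> x y; apply: adj_sym. Qed.

Lemma blowup_irr : irreflexive blowup_rel.
Proof. by move=> x; apply: adj_irr. Qed.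

Definition blowup : sgraph ('I_k * 'I_n)%type := SGraph blowup_sym blowup_irr.

Variable G : sgraph ('I_k * 'I_n)%type.

Definition canonical_copies : {set {ffun 'I_k -> 'I_n}} :=
  [set u : {ffun 'I_k -> 'I_n} |
    [forall i, forall j, H i j ==> G (i, u i) (j, u j)]].

(* S i stands for the subset {i} x S i of U_i; the copy is one of
   H[#|S 0|, ..., #|S (k-1)|]. *)
Definition canonical_blowup_copy (S : 'I_k -> {set 'I_n}) : Prop :=
  forall i j, H i j ->
  forall a b, a \in S i -> b \in S j -> G (i, a) (j, b).

End Blowup.

(* Main.v *)
(* Following Nikiforov, induct on k, keeping as invariant s members of a dense
   family M of canonical copies that are pairwise disjoint and between which all
   required edges are present.  A positive proportion of the (k-1)-prefixes
   extend to many members of M; the induction hypothesis with density rho/2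
   selects m of them, m larger than s by a factor at least 8/rho.  Counting
   injections of s points into the neighbourhoods in the bipartite graph
   (selected prefixes) x U_k yields s prefixes with a common set Y of at least
   (rho/4) (rho/16)^s n extensions, which exceeds n^(1 - rho^(k-1)). *)

Require Import Defs.
From HB Require Import structures.
From mathcomp Require Import all_boot all_order all_algebra.
From mathcomp Require Import all_classical all_reals all_analysis.
From mathcomp Require Import ring lra zify.
Import Order.TTheory GRing.Theory Num.Theory.
Local Open Scope ring_scope.

Set Implicit Arguments.
Unset Strict Implicit.
Unset Printing Implicit Defensive.

(** * Averaging and double counting in dense bipartite graphs *)

Section Counting.
Variable R : realType.

Lemma natr_card (T : finType) (A : {set T}) :
  #|A|%:R = \sum_x (x \in A)%:R :> R.
Proof.
rewrite -sum1_card natr_sum big_mkcond /=.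
by apply: eq_bigr => x _; case: (x \in A).
Qed.

(** Points with [d x] below [c / 2 * D] account for at most half of the guaranteed sum, and each
    remaining point contributes at most [D]. *)
Lemma card_popular (T : finType) (d : T -> R) (D c : R) :
  0 < D -> 0 <= c -> (forall x, d x <= D) ->
  c * D * #|T|%:R <= \sum_x d x ->
  c / 2 * #|T|%:R <= #|[set x | c / 2 * D <= d x]|%:R.
Proof.
move=> D0 c0 dD le_sum; set A := [set x | _].
have le_d x : d x <= D * (x \in A)%:R + c / 2 * D.
  rewrite inE; case: (leP (c / 2 * D) (d x)) => [_|/ltW]; last by rewrite mulr0n mulr0 add0r.
  by rewrite mulr1n mulr1; apply: le_trans (dD x) _; rewrite lerDl; nra.
have : \sum_x d x <= D * #|A|%:R + c / 2 * D * #|T|%:R.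
  apply: (le_trans (ler_sum _ (fun x _ => le_d x))).
  by rewrite big_split /= -mulr_sumr sumr_const -natr_card [c / 2 * D * _]mulr_natr.
move=> /(le_trans le_sum) le2.
rewrite -(ler_pM2l D0); lra.
Qed.

Lemma exprn_le_ffact (z : R) (d s : nat) :
  0 <= z -> (forall i, (i < s)%N -> z <= (d - i)%:R) -> z ^+ s <= (d ^_ s)%:R.
Proof.
move=> z0; elim: s => [|s IHs] zd; first by rewrite expr0.
rewrite ffactnSr natrM exprSr; apply: ler_pM => //; first exact: exprn_ge0.
- by apply: IHs => i /ltnW; apply: zd.
- exact: zd.
Qed.

Lemma exists_ge_average (T : finType) (g : T -> R) (K : R) :
  (0 < #|T|)%N -> #|T|%:R * K <= \sum_x g x -> exists x, K <= g x.
Proof.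
move=> T0 le_sum; apply: contrapT => /forallNP noK.
have : \sum_x g x < \sum_(x : T) K.
  apply: ltr_sum => [|x _]; last by rewrite ltNge; apply/negP.
  by case/card_gt0P: T0 => x _; apply/hasP; exists x; rewrite ?mem_index_enum.
by rewrite sumr_const -mulr_natl ltNge le_sum.
Qed.

(** Double counting of pairs ([f], [b]) with [f] an injection of ['I_s] into the neighbourhood of
    [b], averaged over all [#|A| ^ s] maps. The successor in the size hypothesis absorbs the
    rounding when [#|A|] is the integer part of a real bound. *)
Lemma dense_bipartite (A B : finType) (F : A -> B -> bool) (rho : R) (s : nat) :
  0 < rho -> rho <= 1 -> (0 < s)%N -> (0 < #|B|)%N ->
  8 * s%:R <= rho * #|A|.+1%:R ->
  (forall a, rho / 2 * #|B|%:R <= #|[set b | F a b]|%:R) ->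
  exists (f : 'I_s -> A) (Y : {set B}),
    [/\ injective f, forall a b, b \in Y -> F (f a) b
      & rho / 4 * #|B|%:R * (rho / 16) ^+ s <= #|Y|%:R].
Proof.
move=> rho0 rho1 s0 B0 ls degA.
pose m : R := #|A|%:R.
have s1 : (1 : R) <= s%:R by rewrite ler1n.
have {}ls : 8 * s%:R <= rho * (m + 1) by rewrite /m natr1.
have m7 : 7 <= m by nra.
pose N b := [set a | F a b].
pose good := [set b | rho / 4 * m <= #|N b|%:R].
have card_good : rho / 4 * #|B|%:R <= #|good|%:R.
  have := @card_popular B (fun b => #|N b|%:R) m (rho / 2).
  have -> : rho / 2 / 2 = rho / 4 by field.
  apply; [lra|lra|by move=> b; rewrite ler_nat max_card|].
  have -> : \sum_b #|N b|%:R = \sum_a #|[set b | F a b]|%:R :> R.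
    under eq_bigr do rewrite natr_card.
    rewrite exchange_big /=; apply: eq_bigr => a _; rewrite natr_card.
    by apply: eq_bigr => b _; rewrite !inE.
  apply: le_trans (ler_sum _ (fun a _ => degA a)).
  by rewrite sumr_const [leLHS]mulrAC [leLHS]mulr_natr.
(* As [s <= rho * (m + 1) / 8], a degree [d >= rho / 4 * m] and [i < s] give
   [d - i >= rho * m / 8 >= z], which bounds every factor of the falling factorial. *)
pose z := rho * m / 16.
have z0 : 0 <= z by rewrite /z; nra.
have good_ffact b : b \in good -> z ^+ s <= (#|N b| ^_ s)%:R.
  rewrite inE => gb; apply: exprn_le_ffact => // i lis.
  have lis' : i%:R + 1 <= s%:R :> R by rewrite natr1 ler_nat.
  have lid : (i <= #|N b|)%N.
    by rewrite -(ler_nat R); nra.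
  rewrite natrB // /z; nra.
pose Y (f : {ffun 'I_s -> A}) := [set b | injectiveb f & f \in ffun_on (mem (N b))].
have sumY : \sum_f #|Y f|%:R = \sum_b (#|N b| ^_ s)%:R :> R.
  under eq_bigr do rewrite natr_card.
  rewrite exchange_big /=; apply: eq_bigr => b _.
  have := card_inj_ffuns_on 'I_s (mem (N b)); rewrite card_ord => <-.
  by rewrite natr_card; apply: eq_bigr => f _; rewrite !inE andbC.
have A0 : (0 < #|A|)%N by rewrite -(ltr_nat R); apply: lt_le_trans m7.
have [||f leY] := @exists_ge_average {ffun 'I_s -> A} (fun f => #|Y f|%:R)
    (rho / 4 * #|B|%:R * (rho / 16) ^+ s).
- by rewrite card_ffun card_ord expn_gt0 A0.
- rewrite sumY card_ffun card_ord natrX.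
  apply: (@le_trans _ _ (\sum_(b in good) z ^+ s)).
    have -> : z = #|A|%:R * (rho / 16) by rewrite /z /m; field.
    rewrite sumr_const mulrCA -exprMn -[leRHS]mulr_natl.
    by apply: ler_wpM2r; rewrite ?exprn_ge0 // mulr_ge0 // divr_ge0 // ltW.
  rewrite big_mkcond /=; apply: ler_sum => b _.
  by case: ifP => // gb; apply: good_ffact.
have Bpos : 0 < #|B|%:R :> R by rewrite ltr0n.
(* [Y f] is empty unless [f] is injective, so its positive lower bound yields injectivity. *)
have /card_gt0P[b0] : (0 < #|Y f|)%N.
  rewrite -(ltr_nat R); apply: lt_le_trans leY.
  by rewrite !mulr_gt0 ?exprn_gt0 ?divr_gt0.
rewrite inE => /andP[/injectiveP injf _].
exists f, (Y f); split=> // a b.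
by rewrite inE => /andP[_ /ffun_onP /(_ a)]; rewrite inE.
Qed.

End Counting.

(** * Appending a last coordinate to a tuple *)

Section Extension.
Variables (T : finType) (k : nat).

Definition ffun_rcons (u : {ffun 'I_k -> T}) (y : T) : {ffun 'I_k.+1 -> T} :=
  [ffun i => if unlift ord_max i is Some j then u j else y].

Lemma ffun_rcons_lift u y i : ffun_rcons u y (lift ord_max i) = u i.
Proof. by rewrite ffunE liftK. Qed.

Lemma ffun_rcons_max u y : ffun_rcons u y ord_max = y.
Proof. by rewrite ffunE unlift_none. Qed.

Lemma card_ffun_rcons (M : {set {ffun 'I_k.+1 -> T}}) :
  #|M| = (\sum_u #|[set y | ffun_rcons u y \in M]|)%N.
Proof.
rewrite -sum1_card (reindex (fun p => ffun_rcons p.1 p.2)) /=; last first.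
  exists (fun v : {ffun 'I_k.+1 -> T} =>
    ([ffun i => v (lift ord_max i)], v ord_max)) => [[u y] _|v _] /=.
    rewrite ffun_rcons_max; congr (_, _); apply/ffunP => i.
    by rewrite ffunE ffun_rcons_lift.
  apply/ffunP => i; rewrite ffunE.
  by case: unliftP => [j ->|-> //]; rewrite ffunE.
rewrite -(pair_big_dep xpredT (fun u y => ffun_rcons u y \in M) (fun _ _ => 1%N)) /=.
apply: eq_bigr => u _; rewrite -sum1_card; apply: eq_bigl => y.
by rewrite inE.
Qed.

End Extension.

(** * Inductive selection of disjoint, mutually compatible copies *)

Section Selection.
(* E i j a b says that the vertices a of U_i and b of U_j are compatible: either
   w_i w_j is not an edge of H, or ab is an edge of G.  Indices are plain
   naturals so that E does not depend on the arity in the induction on k. *)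
Variables (R : realType) (T : finType) (E : nat -> nat -> T -> T -> bool).
Hypothesis E_diag : forall i a b, E i i a b.
Hypothesis E_sym : forall i j a b, E i j a b -> E j i b a.
Hypothesis T_gt0 : (0 < #|T|)%N.

Local Notation L := (ln (#|T|%:R : R)).

(** The real number whose floor is $t$, since $k(k-1) = k^2 - k$. *)
Definition part_size (k : nat) (rho : R) : R := rho ^+ k / 4 ^+ (k * k.-1) * L.

(** With [u = v] this expresses that [u] is a canonical copy; the pairs [i = j] are harmless by
    [E_diag]. *)
Definition cross_adjacent k (u v : {ffun 'I_k -> T}) :=
  forall i j : 'I_k, E i j (u i) (v j).

(** [M] is an arbitrary dense family because the induction applies this to prefixes with many
    extensions, which need not be all copies of the smaller graph. *)
Definition selectable (k : nat) := forall (rho : R) (s : nat)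
  (M : {set {ffun 'I_k -> T}}),
  0 < rho -> rho <= 1 -> s%:R <= part_size k rho ->
  rho * #|T|%:R ^+ k <= #|M|%:R -> (forall u, u \in M -> cross_adjacent u u) ->
  exists f : 'I_s -> {ffun 'I_k -> T},
    [/\ forall a, f a \in M, forall a b, cross_adjacent (f a) (f b)
      & forall i, injective (fun a => f a i)].

Lemma L_ge0 : 0 <= L.
Proof. by rewrite ln_ge0 // ler1n. Qed.

Lemma expR_L : expR L = #|T|%:R.
Proof. by rewrite lnK // posrE ltr0n. Qed.

(** Halving the density costs [2 ^+ k], while the power of 4 gains [4 ^+ (2 * k) = 2 ^+ k * 8 ^+ k];
    the surplus [8 ^+ k] is at least 8. *)
Lemma part_size_half k (rho : R) : (0 < k)%N -> 0 < rho -> rho <= 1 ->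
  8 * part_size k.+1 rho <= rho * part_size k (rho / 2).
Proof.
move=> k0 rho0 rho1; rewrite /part_size.
have -> : (k.+1 * k.+1.-1 = k * k.-1 + 2 * k)%N by case: k k0 => //= k _; lia.
rewrite exprD [4 ^+ (2 * k)]exprM expr_div_n exprS.
have -> : (4 ^+ 2 : R) = 2 * 8 by ring.
rewrite exprMn.
have p4 : 0 < (4 : R) ^+ (k * k.-1) by rewrite exprn_gt0.
have p2 : 0 < (2 : R) ^+ k by rewrite exprn_gt0.
have p8 : 8 <= (8 : R) ^+ k.
  by rewrite -{1}[8]expr1 ler_weXn2l // ler1n.
have p8' : 0 < (8 : R) ^+ k by lra.
set X := rho * rho ^+ k / 2 ^+ k / 4 ^+ (k * k.-1) * L.
have X0 : 0 <= X.
  by rewrite !mulr_ge0 ?invr_ge0 ?exprn_ge0 ?L_ge0 // ltW.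
have -> : rho * (rho ^+ k / 2 ^+ k / 4 ^+ (k * k.-1) * L) = X.
  by rewrite /X; ring.
have -> : 8 * (rho * rho ^+ k / (4 ^+ (k * k.-1) * (2 ^+ k * 8 ^+ k)) * L)
   = X * (8 / 8 ^+ k).
  by rewrite /X; field; rewrite !gt_eqF.
by rewrite ler_piMr // ler_pdivrMr // mul1r.
Qed.

Lemma part_size_le k (rho : R) : (0 < k)%N -> 0 < rho ->
  16 * part_size k.+1 rho <= rho * (rho ^+ k * L).
Proof.
move=> k0 rho0; rewrite /part_size exprS.
set p := 4 ^+ _.
have p16 : 16 <= p.
  have -> : 16 = 4 ^+ 2 :> R by ring.
  by rewrite /p ler_weXn2l ?ler1n //=; case: k k0 {p} => //= k _; lia.
have p0 : 0 < p by lra.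
have -> : 16 * (rho * rho ^+ k / p * L) = rho * (rho ^+ k * L) * (16 / p).
  by field; rewrite gt_eqF.
rewrite ler_piMr ?ler_pdivrMr ?mul1r //.
by rewrite !mulr_ge0 ?exprn_ge0 ?L_ge0 // ltW.
Qed.

(** With [r = 1 / rho], the factors [rho / 4] and [rho / 16] are at least [expR (- (4 * r))] and
    [expR (- (5 * r))]. The total loss in the exponent is at most [9 * r * s], hence at most
    [9 / 16 * Y]. *)
Lemma common_size_bound (rho Y : R) (s : nat) :
  0 < rho -> rho <= 1 -> (0 < s)%N -> 16 * s%:R <= rho * Y ->
  expR (L - 9 / 16 * Y) <= rho / 4 * #|T|%:R * (rho / 16) ^+ s.
Proof.
move=> rho0 rho1 s0 lsY.
have s1 : (1 : R) <= s%:R by rewrite ler1n.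
set r := rho^-1.
have r1 : 1 <= r by rewrite invf_ge1.
have lsY' : 16 * (s%:R * r) <= Y.
  by rewrite mulrA ler_pdivrMr // [Y * _]mulrC.
have e4 : expR (- (4 * r)) <= rho / 4.
  rewrite -[rho / 4]invrK invf_div expRN lef_pV2 ?posrE ?expR_gt0 ?divr_gt0 //.
  by apply: le_trans (expR_ge1Dx _); rewrite /r; lra.
have e16 : expR (- (5 * r)) <= rho / 16.
  rewrite -[rho / 16]invrK invf_div expRN lef_pV2 ?posrE ?expR_gt0 ?divr_gt0 //.
  rewrite -/r expRM_natl.
  have er := expR_ge1Dx r; set e := expR r in er *.
  (* Four factors [e] are bounded below by 2 and the fifth by [r], giving
     [16 * r <= expR (5 * r)]. *)
  have : 2 ^+ 4 * r <= e ^+ 4 * e.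
    by apply: ler_pM; [lra|lra|apply: lerXn2r; rewrite ?nnegrE; lra|lra].
  by rewrite -exprSr; lra.
apply: (@le_trans _ _ (expR (- (4 * r)) * #|T|%:R * expR (- (5 * r)) ^+ s)).
  rewrite -[X in _ <= _ * X * _]expR_L -expRM_natl -!expRD ler_expR.
  by have := ler_wpM2r (ltW (lt_le_trans ltr01 r1)) s1; lra.
apply: ler_pM => //.
- by rewrite ler_wpM2r.
- by apply: lerXn2r => //; rewrite nnegrE ?expR_ge0 // divr_ge0 // ltW.
Qed.

(** Shared by the induction, which cuts [Y] down to [s] points, and by the final argument, which
    keeps all of [Y] as the large last part. *)
Lemma selectable_step k (rho : R) (s : nat) (M : {set {ffun 'I_k.+1 -> T}}) :
  (0 < k)%N -> selectable k -> 0 < rho -> rho <= 1 -> (0 < s)%N ->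
  s%:R <= part_size k.+1 rho ->
  rho * #|T|%:R ^+ k.+1 <= #|M|%:R -> (forall u, u \in M -> cross_adjacent u u) ->
  exists (f : 'I_s -> {ffun 'I_k -> T}) (Y : {set T}),
    [/\ forall a b, cross_adjacent (f a) (f b),
        forall i, injective (fun a => f a i),
        forall a y, y \in Y -> ffun_rcons (f a) y \in M
      & expR (L - 9 / 16 * (rho ^+ k * L)) <= #|Y|%:R].
Proof.
move=> k0 IHk rho0 rho1 s0 les cardM crossM.
have n0 : 0 < #|T|%:R :> R by rewrite ltr0n.
pose deg u := #|[set y | ffun_rcons u y \in M]|.
pose N := [set u : {ffun 'I_k -> T} | rho / 2 * #|T|%:R <= (deg u)%:R].
have cardN : rho / 2 * #|T|%:R ^+ k <= #|N|%:R.
  have := @card_popular R {ffun 'I_k -> T} (fun u => (deg u)%:R) #|T|%:R rho n0.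
  rewrite card_ffun card_ord natrX; apply; first exact: ltW.
    by move=> u; rewrite ler_nat max_card.
  by rewrite -natr_sum -card_ffun_rcons -mulrA -exprS.
have rho2 : 0 < rho / 2 by lra.
have size0 : 0 <= part_size k (rho / 2).
  by rewrite !mulr_ge0 ?invr_ge0 ?exprn_ge0 ?L_ge0 // ltW.
(* Rounding down leaves [part_size k (rho / 2) < m + 1], which is what the degree count needs. *)
have /andP[lem ltm] := truncn_itv size0.
set m := Num.trunc _ in lem ltm.
have crossN u : u \in N -> cross_adjacent u u.
  rewrite inE => degu i j.
  have /card_gt0P[y] : (0 < deg u)%N.
    by rewrite -(ltr_nat R); apply: lt_le_trans degu; rewrite mulr_gt0.
  rewrite inE => /crossM /(_ (lift ord_max i) (lift ord_max j)).
  by rewrite !ffun_rcons_lift !lift_max.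
have [|g [gN gcross ginj]] := IHk (rho / 2) m N rho2 _ lem cardN crossN.
  lra.
have [||h [Y [hinj hY cardY]]] :=
  @dense_bipartite R 'I_m T (fun a y => ffun_rcons (g a) y \in M) rho s rho0 rho1 s0 T_gt0.
- rewrite card_ord.
  have := part_size_half k0 rho0 rho1; nra.
- by move=> a; have := gN a; rewrite inE.
exists (g \o h), Y; split=> //.
- by move=> a b; apply: gcross.
- by move=> i a b /= /ginj /hinj.
- apply: le_trans cardY; apply: common_size_bound => //.
  by apply: le_trans (part_size_le k0 rho0); rewrite ler_pM2l.
Qed.

(** Any [s] distinct members will do: [s <= rho * L <= rho * #|T|], and tuples of length one differ
    in their only coordinate. *)
Lemma selectable1 : selectable 1.
Proof.
move=> rho s M rho0 rho1; rewrite /part_size mul1n expr0 divr1 !expr1 => les cardM crossM.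
have lesM : (s <= #|M|)%N.
  rewrite -(ler_nat R); apply: le_trans cardM; apply: le_trans les _.
  rewrite ler_pM2l // -[leRHS]expR_L; apply: le_trans (expR_ge1Dx _); lra.
exists (fun a => enum_val (widen_ord lesM a)); split.
- by move=> a; apply: enum_valP.
- by move=> a b i j; rewrite !ord1.
- move=> i a b eqi; apply/val_inj.
  have /enum_val_inj/(congr1 val) // : enum_val (widen_ord lesM a) = enum_val (widen_ord lesM b).
  by apply/ffunP => j; rewrite (ord1 j) -(ord1 i).
Qed.

Lemma selectable_gt0 k : (0 < k)%N -> selectable k.
Proof.
case: k => // k _; elim: k => [|k IHk]; first exact: selectable1.
move=> rho [|s] M rho0 rho1 les cardM crossM.
  have /card_gt0P[y0 _] := T_gt0.
  by exists (fun=> [ffun=> y0]); split=> [[]|[]|i []].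
have [f [Y [fcross finj fM cardY]]] :=
  selectable_step (ltn0Sn k) IHk rho0 rho1 (ltn0Sn s) les cardM crossM.
(* The exponent in [cardY] is at least [7 / 16 * (q * L)] for [q = rho ^+ k.+1], whereas
   [s.+1 <= q * L / 16]. *)
have leY : (s.+1 <= #|Y|)%N.
  rewrite -(ler_nat R); apply: le_trans cardY; apply: le_trans (expR_ge1Dx _).
  have L0 := L_ge0; set q := rho ^+ k.+1.
  have q0 : 0 <= q by rewrite exprn_ge0 // ltW.
  have qL : q * L <= L by rewrite ler_piMl // exprn_ile1 // ltW.
  have rqL : rho * (q * L) <= q * L by rewrite ler_piMl // mulr_ge0.
  have := part_size_le (ltn0Sn k) rho0; rewrite -/q; lra.
(* Every [f a] extends by every point of [Y], so distinct points can be assigned freely, and all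
   cross edges to them are present. *)
pose y a := enum_val (widen_ord leY a).
have yY a : y a \in Y by apply: enum_valP.
exists (fun a => ffun_rcons (f a) (y a)); split.
- by move=> a; apply: fM.
- move=> a b i j.
  have crossy c d l : E (lift ord_max l : 'I_k.+2) (ord_max : 'I_k.+2) (f c l) (y d).
    have := crossM _ (fM c (y d) (yY d)) (lift ord_max l) ord_max.
    by rewrite ffun_rcons_lift ffun_rcons_max.
  case: (unliftP ord_max i) => [i' ->|->]; case: (unliftP ord_max j) => [j' ->|->];
    rewrite ?ffun_rcons_lift ?ffun_rcons_max.
  + by rewrite !lift_max; apply: fcross.
  + exact: crossy.
  + by apply: E_sym; apply: crossy.
  + exact: E_diag.
- move=> i a b; case: (unliftP ord_max i) => [i' ->|->].
    by rewrite !ffun_rcons_lift; apply: finj.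
  by rewrite !ffun_rcons_max => /enum_val_inj /(congr1 val) /= /val_inj.
Qed.

End Selection.

(** * From selected prefixes to vertex sets of the blowup *)

Theorem theorem2p3 (R : realType) (k : nat) (hk : (2 <= k)%N)
  (H : sgraph 'I_k) (n : nat) (hn : (0 < n)%N)
  (rho : R) (hrho0 : 0 < rho) (hrho1 : rho <= 1)
  (G : sgraph ('I_k * 'I_n)%type) (hG : subgraph G (blowup n H))
  (hcopies : rho * n%:R ^+ k <= #|canonical_copies H G|%:R) :
  exists S : 'I_k -> {set 'I_n},
    [/\ forall i : 'I_k, (i.+1 < k)%N ->
          #|S i|%:Z =
            Num.floor (rho ^+ k * 4 ^ (- k%:Z ^+ 2 + k%:Z) * ln (n%:R : R)),
        forall i : 'I_k, i.+1 = k ->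
          (n%:R : R) `^ (1 - rho ^+ k.-1) <= #|S i|%:R
      & canonical_blowup_copy H G S].
Proof.
case: k hk H G hG hcopies => // k hk H G _ hcopies.
have -> : rho ^+ k.+1 * 4 ^ (- k.+1%:Z ^+ 2 + k.+1%:Z) * ln (n%:R : R)
    = @part_size R 'I_n k.+1 rho.
  rewrite /part_size card_ord; congr (_ * _ * _).
  have -> : - k.+1%:Z ^+ 2 + k.+1%:Z = - (k.+1 * k)%N%:Z by lia.
  by rewrite -exprnN.
have T_gt0 : (0 < #|'I_n|)%N by rewrite card_ord.
set x := part_size _ _ _.
have x0 : 0 <= x.
  by rewrite !mulr_ge0 ?invr_ge0 ?exprn_ge0 ?L_ge0 // ltW.
have [s floorE] : exists s : nat, Num.floor x = s%:Z.
  by have := floor_ge0 x; rewrite x0; case: (Num.floor x) => // s _; exists s.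
have les : s%:R <= x by have := floor_le_tmp x; rewrite floorE.
have lnE : n%:R = expR (ln (n%:R : R)) by rewrite lnK // posrE ltr0n.
have ln0 : 0 <= ln (n%:R : R) by rewrite ln_ge0 // ler1n.
have rk0 : 0 <= rho ^+ k by rewrite exprn_ge0 // ltW.
have powE : n%:R `^ (1 - rho ^+ k) = expR (ln (n%:R : R) - rho ^+ k * ln (n%:R : R)).
  by rewrite {1}lnE -expRM mulrC mulrBl mul1r.
rewrite floorE /= powE; case: (posnP s) => [s0|s0].
  (* For $t = 0$ the last class is taken whole and all others empty; irreflexivity of [H] leaves no
     edge to check. *)
  exists (fun i => [set _ | i == ord_max]); split.
  - move=> i; rewrite ltnS -val_eqE /= => /ltn_eqF ->.
    by rewrite s0 cardsE card0.
  - move=> i [ik]; have -> : i = ord_max by apply/val_inj.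
    rewrite eqxx cardsE card_ord [leRHS]lnE ler_expR.
    by rewrite gerBl mulr_ge0.
  - move=> i j Hij a b; rewrite !inE => /eqP ei /eqP ej.
    by rewrite ei ej adj_irr in Hij.
pose E i j (a b : 'I_n) := H (inord i) (inord j) ==> G (inord i, a) (inord j, b).
have E_diag i a b : E i i a b by rewrite /E adj_irr.
have E_sym i j a b : E i j a b -> E j i b a.
  by rewrite /E adj_sym (adj_sym G).
have copies_cross u : u \in canonical_copies H G -> cross_adjacent E u u.
  by rewrite inE => /forallP uG i j; rewrite /E !inord_val; have /forallP := uG i; apply.
have cardM : rho * #|'I_n|%:R ^+ k.+1 <= #|canonical_copies H G|%:R by rewrite card_ord.
have sel := @selectable_gt0 R 'I_n E E_diag E_sym T_gt0 k hk.
have [f [Y [fcross finj fM]]] :=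
  selectable_step T_gt0 hk sel hrho0 hrho1 s0 les cardM copies_cross.
rewrite card_ord => cardY.
pose S (i : 'I_k.+1) : {set 'I_n} :=
  if unlift ord_max i is Some j then [set f a j | a : 'I_s] else Y.
exists S; split.
- move=> i; rewrite /S; case: unliftP => [j _ _|-> /=]; last by rewrite ltnn.
  by rewrite card_imset ?card_ord //; apply: finj.
- move=> i; rewrite /S; case: unliftP => [j ->|_ _].
    by rewrite lift_max => -[ej]; have := ltn_ord j; rewrite ej ltnn.
  (* The exponent may drop by [rho ^+ k * ln n], and only 9/16 of that has been lost. *)
  by apply: le_trans cardY; rewrite ler_expR; nra.
- have SY c d l : d \in Y -> H (lift ord_max l) ord_max ->
      G (lift ord_max l, f c l) (ord_max, d).
    move=> dY Hl; have := copies_cross _ (fM c d dY) (lift ord_max l) ord_max.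
    by rewrite /E !inord_val ffun_rcons_lift ffun_rcons_max Hl.
  move=> i j; rewrite /S.
  case: (unliftP ord_max i) => [i' ->|->]; case: (unliftP ord_max j) => [j' ->|->] Hij a b.
  + move=> /imsetP[c _ ->] /imsetP[d _ ->].
    have := fcross c d i' j'; rewrite /E -!(lift_max i') -!(lift_max j').
    by rewrite !inord_val Hij.
  + by move=> /imsetP[c _ ->] bY; apply: SY.
  + move=> aY /imsetP[c _ ->]; rewrite adj_sym; apply: SY => //.
    by rewrite adj_sym.
  + by rewrite adj_irr in Hij.
Qed.
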